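(* Let $c\ge 0$ and $d\in\{0,1,2,\dots\}$ be fixed, let $\lambda>0$, and set $q=e^{-\lambda/N}$, $\alpha=cN+d$, $\mathsf{s}=e^{-\lambda}$. Let $N\to\infty$ along integers for which $\alpha$ is a nonnegative integer. Then for every fixed integer $p\ge 1$, $$ \lim_{N\to\infty}\frac{1}{N}m_{N,p}^{(\mathrm{qL})}=\mathcal{M}_p^{(\mathrm{qL})}:=\frac{1}{\lambda p}\sum_{m=0}^{p}\binom{p}{m}\mathsf{s}^{cm}(1-\mathsf{s}^c)^{p-m}\,I_{1-\mathsf{s}}(m+1,p). $$ Moreover, if $c=0$ (so $\alpha=d$), then for every fixed integer $p\ge 1$, as $N\to\infty$, $$ m_{N,p}^{(\mathrm{qL})}=N\,\mathcal{M}_p^{(\mathrm{qL})}\big|_{c=0}+\frac12 I_{1-\mathsf{s}}(p+1,p)+\frac{d}{2}\binom{2p}{p}\mathsf{s}^p(1-\mathsf{s})^p+O\Big(\frac1N\Big), $$ where $\mathcal{M}_p^{(\mathrm{qL})}\big|_{c=0}=\frac{1}{\lambda p}I_{1-\mathsf{s}}(p+1,p)$.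
   Context: The $q$-LUE of size $N$ with parameters $q\in(0,1)$, $\alpha>-1$ is the random configuration $(x_1,\dots,x_N)$ with each $x_j\in\{1,q,q^2,\dots\}$ and joint probability proportional to $\prod_{1\le j<k\le N}(x_j-x_k)^2\prod_{j=1}^N x_j^{\alpha}(qx_j;q)_\infty$, where $(x;q)_\infty=\prod_{k\ge0}(1-xq^k)$. Its spectral moments are $m_{N,p}^{(\mathrm{qL})}=\mathbb{E}\big[\sum_{j=1}^N x_j^p\big]$. For $a,b>0$ and $0<x<1$, $I_x(a,b)=\frac{\Gamma(a+b)}{\Gamma(a)\Gamma(b)}\int_0^x t^{a-1}(1-t)^{b-1}\,dt$ is the regularised incomplete beta function.
   Formalization: The joint probability carries an extra factor x_j for each particle (Jackson measure, weight x_j^{α+1}(qx_j;q)_∞); without it the ensemble is not normalisable at α=0 and the c=0 expansion would have d−1 in place of d. *)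

(* Defs.v *)
From HB Require Import structures.
From mathcomp Require Import all_boot all_order all_algebra.
From mathcomp Require Import all_classical all_reals all_analysis.
Set Implicit Arguments. Unset Strict Implicit. Unset Printing Implicit Defensive.
Import Order.TTheory GRing.Theory Num.Theory.
Import numFieldNormedType.Exports.
Local Open Scope classical_set_scope.
Local Open Scope ring_scope.

Section QLUE.
Variable R : realType.

Definition qpoch_inf (x q : R) : R :=
  limn (fun n : nat => \prod_(i < n) (1 - x * q ^+ i)).

(* Weight of a configuration x = (x_0,..,x_{N-1}), with x_j = q^{k_j}:
   prod_{i<j} (x_i - x_j)^2 * prod_j x_j^alpha (q x_j; q)_oo, taken with
   respect to the Jackson measure d_q x (which contributes the factor x_j
   at the lattice point x_j = q^{k_j}). *)
Definition qLUE_weight (N alpha : nat) (q : R) (x : 'I_N -> R) : R :=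
  (\prod_(i < N) \prod_(j < N | (i < j)%N) (x i - x j) ^+ 2) *
  \prod_(j < N) (x j ^+ alpha * qpoch_inf (q * x j) q * x j).

Definition qLUE_trunc (N alpha : nat) (q : R) (F : ('I_N -> R) -> R) (K : nat) : R :=
  \sum_(k : {ffun 'I_N -> 'I_K})
     F (fun j => q ^+ (k j)) * qLUE_weight alpha q (fun j => q ^+ (k j)).

(* m_{N,p} = E[ sum_j x_j^p ]: ratio of the (nonnegative-term) sums over all
   configurations in {1,q,q^2,...}^N, each computed as the limit of the
   truncations k_j < K. *)
Definition qLUE_moment (N alpha : nat) (q : R) (p : nat) : R :=
  limn (@qLUE_trunc N alpha q (fun x => \sum_(j < N) x j ^+ p)) /
  limn (@qLUE_trunc N alpha q (fun _ => 1)).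

Definition betainc (x : R) (a b : nat) : R :=
  (\int[lebesgue_measure]_(t in `[0, x]) (t ^+ a.-1 * (1 - t) ^+ b.-1)) /
  beta_fun a b.

Definition Mq (c lam : R) (p : nat) : R :=
  let s := expR (- lam) in
  (lam * p%:R)^-1 *
  \sum_(m < p.+1) ('C(p, m)%:R * (s `^ c) ^+ m * (1 - s `^ c) ^+ (p - m) *
                   betainc (1 - s) m.+1 p).

End QLUE.

(* Main.v *)
(* Multiplying the Vandermonde determinant by the power sum of degree p raises
   one of its exponents by p, so Andreief's identity writes the moment as a sum
   over i < N of ratios of Hankel determinants.  The moments of the little
   q-Laguerre weight are proportional to (q^(a+1);q)_n, which turns these
   determinants into Vandermonde determinants in the powers of q:

     m_(N,p) = sum_i (q^(a+1+i);q)_p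
                     prod_(j != i) (q^(i+p) - q^j) / (q^i - q^j).

   Only the last p terms survive, with coefficients given by the q-binomial
   theorem.  With G(x) = (x;q)_p (q^a x;q)_p = sum_j G_j x^j, this gives

     m_(N,p) = (1 - q^p)^(-1)
                 sum_j G_j (q^N)^j (q^(1-j);q)_(p-1) / (q;q)_(p-1),

   a finite sum in which every factor has an explicit expansion to first order
   in 1/N.  The limiting functional P |-> sum_j w_j P_j s^j, where
   w_j = prod_(0 < t < p) (t - j) / t, sends (1-x)^(p+m) to I_(1-s)(m+1,p), as
   one sees by differentiating in s, and (1 - s^c x)^p is expanded in powers of
   1 - x. *)
Require Import Defs.
From mathcomp Require Import all_boot all_order all_algebra.
From mathcomp Require Import all_classical all_reals all_analysis.
From mathcomp Require Import perm ring lra.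
Import Order.TTheory GRing.Theory Num.Theory.
Import numFieldNormedType.Exports.
Local Open Scope ring_scope.
Set Implicit Arguments.
Unset Strict Implicit.
Unset Printing Implicit Defensive.

(** * Determinants *)

Section Determinants.
Variable R : comNzRingType.

Definition hankel_det (N : nat) (mu : nat -> R) (l : 'I_N -> nat) : R :=
  \det (\matrix_(i < N, j < N) mu (l i + j)%N).

Definition diff_prod (n : nat) (z : 'I_n -> R) : R :=
  \prod_(i < n) \prod_(j < n | (i < j)%N) (z j - z i).

Lemma hankel_detZ (N : nat) (c : R) (mu : nat -> R) (l : 'I_N -> nat) :
  hankel_det (fun n => c * mu n) l = c ^+ N * hankel_det mu l.
Proof.
by rewrite -detZ; congr (\det _); apply/matrixP => i j; rewrite !mxE.
Qed.

Lemma det_powers (n : nat) (z : 'I_n -> R) :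
  \det (\matrix_(i < n, j < n) z j ^+ i) = diff_prod z.
Proof.
have -> : \matrix_(i < n, j < n) z j ^+ i = Vandermonde n (\row_j z j).
  by apply/matrixP => i j; rewrite !mxE.
rewrite det_Vandermonde; apply: eq_bigr => i _.
by apply: eq_bigr => j _; rewrite !mxE.
Qed.

Lemma det_poly_Vandermonde (n : nat) (P : 'I_n -> {poly R}) (z : 'I_n -> R) :
  (forall j : 'I_n, (size (P j) <= j.+1)%N) ->
  \det (\matrix_(i, j) (P j).[z i]) = (\prod_j (P j)`_j) * diff_prod z.
Proof.
move=> szP; pose U : 'M[R]_n := \matrix_(j, k) (P j)`_k.
have -> : \matrix_(i, j) (P j).[z i] = (U *m \matrix_(k, i) z i ^+ k)^T.
  apply/matrixP => i j; rewrite !mxE (@horner_coef_wide _ n).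
    by apply: eq_bigr => k _; rewrite !mxE.
  exact: leq_trans (szP j) (ltn_ord j).
rewrite det_tr det_mulmx det_powers det_trig; last first.
  apply/is_trig_mxP => j k jk; rewrite mxE nth_default //.
  exact: leq_trans (szP j) jk.
by congr (_ * _); apply: eq_bigr => j _; rewrite mxE.
Qed.

Lemma det_scale_cols (n : nat) (M : 'M[R]_n) (c : 'I_n -> R) :
  \det (\matrix_(i, j) (M i j * c j)) = \det M * \prod_j c j.
Proof.
have <- : M *m diag_mx (\row_j c j) = \matrix_(i, j) (M i j * c j).
  by rewrite mul_mx_diag; apply/matrixP => i j; rewrite !mxE.
by rewrite det_mulmx det_diag; under eq_bigr do rewrite mxE.
Qed.

Lemma sum_det_scale_row (n : nat) (M : 'M[R]_n) (x : 'I_n -> R) :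
  \sum_i \det (\matrix_(k, j) (M k j * (if k == i then x j else 1))) =
  (\sum_j x j) * \det M.
Proof.
rewrite /determinant exchange_big big_distrr /=; apply: eq_bigr => s _.
rewrite -big_distrr /= mulrCA; congr (_ * _).
rewrite [\sum_j x j](reindex_inj (@perm_inj _ s)) /= big_distrl /=.
apply: eq_bigr => i _.
under eq_bigr => k _ do rewrite mxE.
rewrite big_split /= mulrC; congr (_ * _).
by rewrite -big_mkcond /= big_pred1_eq.
Qed.

(* Up to the sign [(-1) ^ #{j > i}], [diff_prod z] is the product of the
   [z i - z j] over [j != i] and of factors that do not involve [z i]. *)
Lemma diff_prod_update (n : nat) (z z' : 'I_n -> R) (i : 'I_n) :
  (forall j, j != i -> z' j = z j) ->
  diff_prod z' * \prod_(j < n | j != i) (z i - z j) =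
  diff_prod z * \prod_(j < n | j != i) (z' i - z j).
Proof.
move=> zz'.
pose off_i (y : 'I_n -> R) :=
  \prod_(k < n | k != i) \prod_(j < n | (k < j)%N && (j != i)) (y j - y k).
have split_i y : diff_prod y =
    (\prod_(j < n | (i < j)%N) -1) * \prod_(j < n | j != i) (y i - y j) *
    off_i y.
  have -> : \prod_(j < n | j != i) (y i - y j) =
      \prod_(j < n | (i < j)%N) (y i - y j) *
      \prod_(j < n | (j < i)%N) (y i - y j).
    rewrite (bigID (fun j : 'I_n => (i < j)%N)) /=; congr (_ * _);
      by apply: eq_bigl => j; rewrite -val_eqE /=; case: ltngtP.
  rewrite mulrA -big_split /= /diff_prod (bigD1 i) //= -mulrA; congr (_ * _).
    by apply: eq_bigr => j _; rewrite mulN1r opprB.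
  have -> : \prod_(k < n | (k < i)%N) (y i - y k) =
      \prod_(k < n | k != i) (if (k < i)%N then y i - y k else 1).
    rewrite -big_mkcondr; apply: eq_bigl => k.
    by rewrite -val_eqE /=; case: ltngtP.
  rewrite -big_split; apply: eq_bigr => k ki /=; case: ifPn => ltki.
    by rewrite (bigD1 i).
  rewrite mul1r; apply: eq_bigl => j; case: eqVneq => [->|]; rewrite ?andbT //.
  by rewrite (negPf ltki).
have offE : off_i z' = off_i z.
  apply: eq_bigr => k ki; apply: eq_bigr => j /andP[_ ji].
  by rewrite !zz'.
have -> : \prod_(j < n | j != i) (z' i - z j) =
    \prod_(j < n | j != i) (z' i - z' j).
  by apply: eq_bigr => j ji; rewrite (zz' j).
by rewrite !split_i offE; ring.
Qed.

End Determinants.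

(** * Discrete ensembles with Vandermonde interaction *)

Section DiscreteEnsemble.
Variable R : comNzRingType.

Lemma andreief (N : nat) (I : finType) (f g : 'I_N -> I -> R) :
  \sum_(k : {ffun 'I_N -> I}) \det (\matrix_(i, j) f i (k j)) *
                              \det (\matrix_(i, j) g i (k j)) =
  N`!%:R * \det (\matrix_(i, j) \sum_x f i x * g j x).
Proof.
set M := \matrix_(i, j) _.
have det_cols (h : 'I_N -> I -> R) (k : {ffun 'I_N -> I}) :
    \det (\matrix_(i, j) h i (k j)) =
    \sum_(s : 'S_N) (-1) ^+ s * \prod_j h (s j) (k j).
  rewrite -det_tr /determinant; apply: eq_bigr => s _; congr (_ * _).
  by apply: eq_bigr => j _; rewrite !mxE.
under eq_bigr => k _ do rewrite (det_cols g) big_distrr.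
rewrite exchange_big /=.
transitivity (\sum_(s : 'S_N) \det M); last first.
  by rewrite sumr_const card_Sn mulr_natl.
apply: eq_bigr => s _.
have -> : \det M = (-1) ^+ s * \det (col_perm s M).
  rewrite col_permE det_mulmx det_perm odd_permV mulrCA -expr2.
  by rewrite sqrr_sign mulr1.
rewrite -[\det (col_perm s M)]det_tr [\det (_^T)]/determinant big_distrr /=.
under eq_bigr => k _ do rewrite (det_cols f) big_distrl.
rewrite exchange_big; apply: eq_bigr => t _ /=.
under [in RHS]eq_bigr => j _ do rewrite !mxE.
rewrite bigA_distr_bigA /= !big_distrr /=; apply: eq_bigr => k _.
by rewrite big_split /= mulrACA [RHS]mulrA [_ ^+ s * _]mulrC.
Qed.

Definition raise_at (N : nat) (i : 'I_N) (p : nat) (j : 'I_N) : nat :=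
  if j == i then (j + p)%N else j.

Variables (N : nat) (I : finType) (x w : I -> R).

Let mu (n : nat) : R := \sum_k x k ^+ n * w k.

Lemma sum_det_powers_diff_prod (l : 'I_N -> nat) :
  \sum_(k : {ffun 'I_N -> I}) \det (\matrix_(i < N, j < N) x (k j) ^+ l i) *
     (diff_prod (x \o k) * \prod_j w (k j)) =
  N`!%:R * hankel_det mu l.
Proof.
have -> : hankel_det mu l =
    \det (\matrix_(i < N, j < N) \sum_k (x k ^+ l i * w k) * x k ^+ j).
  congr (\det _); apply/matrixP => i j; rewrite !mxE; apply: eq_bigr => k _.
  by rewrite exprD mulrAC.
rewrite -andreief; apply: eq_bigr => k _; rewrite mulrCA mulrC -det_powers.
congr (_ * _); rewrite -det_scale_cols.
by congr (\det _); apply/matrixP => i j; rewrite !mxE.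
Qed.

Lemma sum_diff_prod_sqr :
  \sum_(k : {ffun 'I_N -> I}) diff_prod (x \o k) ^+ 2 * \prod_j w (k j) =
  N`!%:R * hankel_det mu (@nat_of_ord N).
Proof.
rewrite -sum_det_powers_diff_prod; apply: eq_bigr => k _.
by rewrite expr2 -mulrA -[X in X * _]det_powers.
Qed.

Lemma sum_power_sum_diff_prod_sqr (p : nat) :
  \sum_(k : {ffun 'I_N -> I}) (\sum_j x (k j) ^+ p) *
     (diff_prod (x \o k) ^+ 2 * \prod_j w (k j)) =
  N`!%:R * \sum_(i < N) hankel_det mu (raise_at i p).
Proof.
rewrite big_distrr /=; under [RHS]eq_bigr do rewrite -sum_det_powers_diff_prod.
rewrite exchange_big /=; apply: eq_bigr => k _.
rewrite -big_distrl /= expr2 -mulrA mulrA; congr (_ * _).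
rewrite -det_powers -sum_det_scale_row; apply: eq_bigr => i _; congr (\det _).
apply/matrixP => b j; rewrite !mxE /raise_at.
by case: eqP => _; rewrite ?mulr1 ?exprD.
Qed.

End DiscreteEnsemble.

(** * The q-Pochhammer symbol *)

Section QPochhammer.
Variable R : comNzRingType.
Implicit Types (x q c : R) (n k : nat).

Definition qpoch x q n : R := \prod_(t < n) (1 - x * q ^+ t).

Lemma qpoch0 x q : qpoch x q 0 = 1.
Proof. exact: big_ord0. Qed.

Lemma qpochSr x q n : qpoch x q n.+1 = qpoch x q n * (1 - x * q ^+ n).
Proof. exact: big_ord_recr. Qed.

Lemma qpochD x q m n : qpoch x q (m + n) = qpoch x q m * qpoch (x * q ^+ m) q n.
Proof.
rewrite /qpoch big_split_ord; congr (_ * _).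
by apply: eq_bigr => i _; rewrite exprD mulrA.
Qed.

Lemma qpochS x q n : qpoch x q n.+1 = (1 - x) * qpoch (x * q) q n.
Proof. by rewrite -add1n qpochD qpochSr qpoch0 expr0 mulr1 mul1r. Qed.

Definition qpoch_poly q c n : {poly R} :=
  \prod_(t < n) (1 - (c * q ^+ t) *: 'X).

Lemma horner_qpoch_poly q c n x : (qpoch_poly q c n).[x] = qpoch (c * x) q n.
Proof.
by rewrite horner_prod; apply: eq_bigr => t _; rewrite !hornerE; ring.
Qed.

Lemma qpoch_poly0 q c : qpoch_poly q c 0 = 1.
Proof. exact: big_ord0. Qed.

Lemma qpoch_polySr q c n :
  qpoch_poly q c n.+1 = qpoch_poly q c n * (1 - (c * q ^+ n) *: 'X).
Proof. exact: big_ord_recr. Qed.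

Lemma size_qpoch_poly_le q c n : (size (qpoch_poly q c n) <= n.+1)%N.
Proof.
have size_factor (t : 'I_n) :
    (size (1 - (c * q ^+ t) *: 'X : {poly R})%R <= 2)%N.
  rewrite (leq_trans (size_polyD _ _)) // size_poly1 geq_max /= size_polyN.
  by rewrite (leq_trans (size_scale_leq _ _)) ?size_polyX.
rewrite (leq_trans (size_prod_leq _ _)) // card_ord leq_subLR addnS ltnS addnn.
rewrite -mul2n mulnC -[X in (_ <= X * _)%N]card_ord -sum_nat_const.
exact: leq_sum.
Qed.

Lemma coefS_qpoch_polyS q c n k :
  (qpoch_poly q c n.+1)`_k.+1 =
  (qpoch_poly q c n)`_k.+1 - c * q ^+ n * (qpoch_poly q c n)`_k.
Proof. by rewrite qpoch_polySr mulrBr mulr1 coefB -scalerAr coefZ coefMX. Qed.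

Lemma coef0_qpoch_poly q c n : (qpoch_poly q c n)`_0 = 1.
Proof.
rewrite -horner_coef0 horner_qpoch_poly mulr0.
by apply: big1 => t _; rewrite mul0r subr0.
Qed.

Lemma coef_qpoch_poly_top q c n :
  (qpoch_poly q c n)`_n = \prod_(t < n) - (c * q ^+ t).
Proof.
elim: n => [|n IH]; first by rewrite coef0_qpoch_poly big_ord0.
rewrite coefS_qpoch_polyS nth_default ?size_qpoch_poly_le // sub0r.
by rewrite big_ord_recr /= -IH mulrN mulrC.
Qed.

Lemma coef_qpoch_poly_rec q n k :
  (qpoch_poly q 1 n)`_k.+1 * (1 - q ^+ k.+1) =
  (qpoch_poly q 1 n)`_k * (q ^+ n - q ^+ k).
Proof.
elim: n k => [|n IH] k.
  rewrite qpoch_poly0 !coef1 mul0r.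
  by case: k => [|k]; rewrite ?mul0r // expr0 subrr mulr0.
case: k => [|k].
  have := IH 0; rewrite coefS_qpoch_polyS !coef0_qpoch_poly mulrBl => ->.
  by rewrite !exprS !expr0; ring.
have := IH k; have := IH k.+1; rewrite !coefS_qpoch_polyS !exprS.
move: (_`_k.+2) (_`_k.+1) (_`_k) (q ^+ k) (q ^+ n) => e2 e1 e0 x y recS rec.
rewrite mulrBl recS.
have -> : (e1 - 1 * y * e0) * (q * y - q * x) =
          e1 * (q * y - q * x) - q * y * (e0 * (y - x)) by ring.
by rewrite -rec; ring.
Qed.

(* [qpoch c q (l + j) = qpoch c q l * qpoch (c * q ^+ l) q j], whose last
   factor is a polynomial of degree [j] in [q ^+ l]. *)
Lemma hankel_det_qpoch (N : nat) q c (l : 'I_N -> nat) :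
  hankel_det (qpoch c q) l =
  (\prod_(j < N) (qpoch_poly q c j)`_j) * (\prod_i qpoch c q (l i)) *
  diff_prod (fun i => q ^+ l i).
Proof.
rewrite mulrAC -det_poly_Vandermonde; last first.
  by move=> j; exact: size_qpoch_poly_le.
rewrite -det_tr -det_scale_cols -det_tr; congr (\det _).
by apply/matrixP => i j; rewrite !mxE horner_qpoch_poly mulrC -qpochD.
Qed.

End QPochhammer.

Section CoefficientMultipliers.
Variable R : comNzRingType.
Implicit Types (w : nat -> R) (P : {poly R}).

Definition scale_coef w P : {poly R} := \poly_(j < size P) (w j * P`_j).

Lemma coef_scale_coef w P j : (scale_coef w P)`_j = w j * P`_j.
Proof.
by rewrite coef_poly; case: ltnP => // szP; rewrite [P`_j]nth_default ?mulr0.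
Qed.

Lemma size_scale_coef_le w P : (size (scale_coef w P) <= size P)%N.
Proof. exact: size_poly. Qed.

Lemma horner_scale_coef w P x :
  (scale_coef w P).[x] = \sum_(j < size P) w j * P`_j * x ^+ j.
Proof. exact: horner_poly. Qed.

Lemma scale_coefZ w a P : scale_coef w (a *: P) = a *: scale_coef w P.
Proof. by apply/polyP => j; rewrite coefZ !coef_scale_coef coefZ mulrCA. Qed.

Lemma scale_coef_sum w (I : Type) (r : seq I) (P : I -> {poly R}) :
  scale_coef w (\sum_(i <- r) P i) = \sum_(i <- r) scale_coef w (P i).
Proof.
apply/polyP => j; rewrite coef_scale_coef !coef_sum big_distrr /=.
by apply: eq_bigr => i _; rewrite coef_scale_coef.
Qed.

Lemma scale_coef_X_deriv w P :
  scale_coef w ('X * P^`()) = 'X * (scale_coef w P)^`().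
Proof.
apply/polyP => -[|j]; rewrite coef_scale_coef !coefXM /= ?mulr0 //.
by rewrite !coef_deriv coef_scale_coef mulrnAr.
Qed.

End CoefficientMultipliers.

Definition qbinom_weight (F : fieldType) (q : F) (n j : nat) : F :=
  qpoch (q / q ^+ j) q n / qpoch q q n.

Notation qbinom_transform q n := (scale_coef (qbinom_weight q n)).

Section QResummation.
Variables (F : fieldType) (q : F).
Hypothesis q_neq0 : q != 0.
Hypothesis oneBqX_neq0 : forall n, 1 - q ^+ n.+1 != 0.

Let qX_neq0 n : q ^+ n != 0. Proof. exact: expf_neq0. Qed.

Lemma expr_inj : injective (fun n => q ^+ n).
Proof.
have expr_neq m n : (m < n)%N -> q ^+ m != q ^+ n.
  move=> mn; rewrite -(subnKC mn) addSnnS exprD eq_sym -subr_eq0.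
  by rewrite -[X in _ - X]mulr1 -mulrBr -opprB mulf_neq0 ?oppr_eq0.
by move=> m n /= E; case: (ltngtP m n) => // /expr_neq; rewrite E eqxx.
Qed.

Lemma qpoch_qq_neq0 n : qpoch q q n != 0.
Proof. by apply/prodf_neq0 => t _; rewrite -exprS. Qed.

Lemma coef_qpoch_polyE n k :
  (qpoch_poly q 1 n)`_k = \prod_(t < k) ((q ^+ n - q ^+ t) / (1 - q ^+ t.+1)).
Proof.
elim: k => [|k IH]; first by rewrite big_ord0 coef0_qpoch_poly.
by rewrite big_ord_recr /= -IH mulrA -coef_qpoch_poly_rec mulfK.
Qed.

Section HankelRatio.
Variable c : F.
Hypothesis c_neq0 : c != 0.
Hypothesis oneBcqX_neq0 : forall n, 1 - c * q ^+ n != 0.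

Lemma hankel_det_qpoch_neq0 (N : nat) :
  hankel_det (qpoch c q) (@nat_of_ord N) != 0.
Proof.
rewrite hankel_det_qpoch !mulf_neq0 //.
- apply/prodf_neq0 => j _; rewrite coef_qpoch_poly_top.
  by apply/prodf_neq0 => t _; rewrite oppr_eq0 mulf_neq0.
- by apply/prodf_neq0 => i _; apply/prodf_neq0.
- apply/prodf_neq0 => i _; apply/prodf_neq0 => j ij.
  by rewrite subr_eq0 (inj_eq expr_inj) gtn_eqF.
Qed.

Lemma hankel_det_qpoch_raise (N p : nat) (i : 'I_N) :
  hankel_det (qpoch c q) (raise_at i p) =
  hankel_det (qpoch c q) (@nat_of_ord N) *
  (qpoch (c * q ^+ i) q p *
   \prod_(j < N | j != i) ((q ^+ (i + p) - q ^+ j) / (q ^+ i - q ^+ j))).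
Proof.
have nodes_neq0 : \prod_(j < N | j != i) (q ^+ i - q ^+ j) != 0.
  apply/prodf_neq0 => j ji; rewrite subr_eq0.
  by rewrite (inj_eq expr_inj) eq_sym.
apply: (mulIf nodes_neq0); rewrite !hankel_det_qpoch big_split prodfV /=.
have /= update := @diff_prod_update _ N
  (fun j => q ^+ j) (fun j => q ^+ raise_at i p j) i.
rewrite -[LHS]mulrA update; last first.
  by move=> j /negPf ji; rewrite /raise_at ji.
have -> : \prod_(j < N) qpoch c q (raise_at i p j) =
    (\prod_(j < N) qpoch c q j) * qpoch (c * q ^+ i) q p.
  rewrite (bigD1 i) //= [in RHS](bigD1 i) //= /raise_at eqxx qpochD mulrAC.
  by congr (_ * _ * _); apply: eq_bigr => j /negPf ->.
rewrite /raise_at eqxx; move: nodes_neq0.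
by set nodes := \prod_(j < N | _) _ => nodes_neq0; field.
Qed.

End HankelRatio.

Lemma prod_nat_neq (G : nat -> F) (N i : nat) : (i < N)%N ->
  \prod_(0 <= j < N | j != i) G j =
  (\prod_(j < i) G j) * \prod_(t < N - i.+1) G (i.+1 + t)%N.
Proof.
move=> iN; rewrite big_mkcond (@big_cat_nat _ _ _ i.+1) //= big_nat_recr //=.
rewrite eqxx mulr1 -{1}[i.+1]add0n big_addn !big_mkord.
congr (_ * _); apply: eq_bigr => j _; first by rewrite ltn_eqF.
by rewrite addnC gtn_eqF // ltn_addr.
Qed.

Lemma prod_ratio_below (i p : nat) :
  \prod_(j < i) ((q ^+ (i + p) - q ^+ j) / (q ^+ i - q ^+ j)) =
  qpoch (q ^+ i.+1) q p / qpoch q q p.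
Proof.
transitivity (qpoch (q * q ^+ p) q i / qpoch q q i).
  rewrite (reindex_inj rev_ord_inj) /= /qpoch -prodf_div.
  apply: eq_bigr => j _ /=; have oneB_neq0 := oneBqX_neq0 j.
  have node_neq0 := qX_neq0 (i - j.+1).
  have iE : q ^+ i = q ^+ (i - j.+1) * q ^+ j.+1 by rewrite -exprD subnK.
  rewrite exprD iE exprS in oneB_neq0 *.
  move: (q ^+ (i - j.+1)) (q ^+ p) (q ^+ j) oneB_neq0 node_neq0.
  move=> y z x oneB_neq0 node_neq0.
  have -> : y * (q * x) - y = - (y * (1 - q * x)) by ring.
  by field; rewrite oneB_neq0 oppr_eq0 mulf_neq0.
apply/eqP; rewrite eqr_div ?qpoch_qq_neq0 // mulrC -qpochD.
by rewrite exprS mulrC -qpochD addnC.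
Qed.

Lemma prod_ratio_above (i n k : nat) :
  \prod_(t < k) ((q ^+ (i + n.+1) - q ^+ (i.+1 + t)) /
                 (q ^+ i - q ^+ (i.+1 + t))) =
  q ^+ k * (qpoch_poly q 1 n)`_k.
Proof.
have -> : q ^+ k = \prod_(t < k) q by rewrite prodr_const card_ord.
rewrite coef_qpoch_polyE -big_split /=.
apply: eq_bigr => t _.
have oneB_neq0 := oneBqX_neq0 t; have node_neq0 := qX_neq0 i.
rewrite addSnnS !exprD !exprS in oneB_neq0 *.
move: (q ^+ i) (q ^+ n) (q ^+ t) oneB_neq0 node_neq0.
move=> y z x oneB_neq0 node_neq0.
have -> : y - y * (q * x) = y * (1 - q * x) by ring.
by field; rewrite oneB_neq0 node_neq0.
Qed.

Lemma sum_coef_horner_div (P G : {poly F}) (x : F) (N : nat) :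
  (size P <= N)%N ->
  \sum_(k < N) q ^+ k * P`_k * G.[x / q ^+ k] =
  (scale_coef (fun j => P.[q / q ^+ j]) G).[x].
Proof.
move=> szP; rewrite horner_scale_coef.
under eq_bigr do rewrite horner_coef big_distrr.
rewrite exchange_big; apply: eq_bigr => j _ /=.
rewrite (horner_coef_wide _ szP) !big_distrl; apply: eq_bigr => k _ /=.
rewrite !exprMn !exprVn -!exprM (mulnC k j).
by field; rewrite qX_neq0.
Qed.

Lemma sum_qpoch_ratio (c : F) (N n : nat) : (n < N)%N ->
  \sum_(i < N) qpoch (c * q ^+ i.+1) q n.+1 *
     \prod_(j < N | j != i) ((q ^+ (i + n.+1) - q ^+ j) / (q ^+ i - q ^+ j)) =
  (qbinom_transform q n
     (qpoch_poly q 1 n.+1 * qpoch_poly q c n.+1)).[q ^+ N] / (1 - q ^+ n.+1).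
Proof.
move=> nN; set G := _ * qpoch_poly q c _.
transitivity ((qpoch q q n.+1)^-1 *
    \sum_(k < N) q ^+ k * (qpoch_poly q 1 n)`_k * G.[q ^+ N / q ^+ k]).
  rewrite big_distrr (reindex_inj rev_ord_inj) /=; apply: eq_bigr => k _.
  have kN := ltn_ord k; set i := (N - k.+1)%N.
  have iN : (i < N)%N by rewrite /i ltn_subrL (leq_trans _ kN).
  have iE : (N - i.+1)%N = k by rewrite /i subnSK // subKn // ltnW.
  have -> : q ^+ N / q ^+ k = q ^+ i.+1 by rewrite -expfB // /i subnSK.
  rewrite -(big_mkord (fun j => j != i)
    (fun j => (q ^+ (i + n.+1) - q ^+ j) / (q ^+ i - q ^+ j))).
  rewrite prod_nat_neq // prod_ratio_below prod_ratio_above iE.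
  by rewrite hornerM !horner_qpoch_poly mul1r; ring.
rewrite sum_coef_horner_div; last first.
  exact: leq_trans (size_qpoch_poly_le _ _ _) nN.
rewrite !horner_scale_coef big_distrr big_distrl; apply: eq_bigr => j _ /=.
rewrite horner_qpoch_poly mul1r /qbinom_weight qpochSr -exprS.
by field; rewrite qpoch_qq_neq0 oneBqX_neq0.
Qed.

End QResummation.

(** * The little q-Laguerre weight *)

Section LittleQLaguerre.
Local Open Scope classical_set_scope.
Variables (R : realType) (q : R).
Hypotheses (q_gt0 : 0 < q) (q_lt1 : q < 1).

Let qX_ge0 n : 0 <= q ^+ n. Proof. exact/exprn_ge0/ltW. Qed.
Let qX_le1 n : q ^+ n <= 1. Proof. by rewrite exprn_ile1 ?ltW. Qed.

Lemma qpoch_ge0 x n : 0 <= x <= 1 -> 0 <= qpoch x q n.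
Proof.
move=> /andP[x0 x1]; apply: prodr_ge0 => i _.
by rewrite subr_ge0 mulr_ile1.
Qed.

Lemma qpoch_noninc x : 0 <= x <= 1 ->
  {homo qpoch x q : m n / (m <= n)%N >-> n <= m}.
Proof.
move=> x01; apply/nonincreasing_seqP => n; rewrite qpochSr.
rewrite ler_piMr ?qpoch_ge0 // gerBl.
by case/andP: x01 => x0 _; rewrite mulr_ge0.
Qed.

Lemma qpoch_cvgn x : 0 <= x <= 1 -> qpoch x q @ \oo --> qpoch_inf x q.
Proof.
move=> x01; apply: nonincreasing_is_cvgn; first exact: qpoch_noninc.
by exists 0 => _ [n _ <-]; rewrite qpoch_ge0.
Qed.

Lemma qpoch_inf_ge0 x : 0 <= x <= 1 -> 0 <= qpoch_inf x q.
Proof.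
move=> x01; apply: limr_ge; first exact: qpoch_cvgn x01.
by apply: nearW => n; exact: qpoch_ge0.
Qed.

Lemma qpoch_inf_le1 x : 0 <= x <= 1 -> qpoch_inf x q <= 1.
Proof.
move=> x01; rewrite -(qpoch0 x q).
exact: nonincreasing_cvgn_ge (qpoch_noninc x01) (qpoch_cvgn x01) 0%N.
Qed.

Lemma qpoch_infM x n : 0 <= x <= 1 ->
  qpoch_inf x q = qpoch x q n * qpoch_inf (x * q ^+ n) q.
Proof.
move=> /andP[x0 x1]; apply/cvg_lim => //; rewrite -(cvg_shiftn n).
under eq_fun do rewrite -/(qpoch x q _) addnC qpochD.
apply: cvgMl_tmp; apply: qpoch_cvgn.
by rewrite mulr_ge0 ?mulr_ile1.
Qed.

Lemma geometric_sum_le n : \sum_(t < n) q ^+ t <= (1 - q)^-1.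
Proof.
rewrite -[leRHS]div1r ler_pdivlMr ?subr_gt0 // -[1 - q]opprB mulrN mulrC.
by rewrite -subrX1 opprB gerBl.
Qed.

Lemma qpoch_ge1B x n : 0 <= x <= 1 -> 1 - x / (1 - q) <= qpoch x q n.
Proof.
move=> x01; have /andP[x0 x1] := x01.
have sum_le_qpoch : 1 - x * \sum_(t < n) q ^+ t <= qpoch x q n.
  elim: n => [|n IH]; first by rewrite qpoch0 big_ord0 mulr0 subr0.
  rewrite qpochSr big_ord_recr /=.
  have : qpoch x q n <= 1 by rewrite -(qpoch0 x q) qpoch_noninc.
  have : 0 <= x * q ^+ n by rewrite mulr_ge0.
  have := qpoch_ge0 n x01; nra.
by apply: le_trans sum_le_qpoch; rewrite lerB // ler_wpM2l // geometric_sum_le.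
Qed.

Lemma qpoch_inf_gt0 x : 0 <= x < 1 -> 0 < qpoch_inf x q.
Proof.
move=> /andP[x0 x1].
have /cvgrPdist_lt/(_ (1 - q)) : q ^+ k @[k --> \oo] --> (0 : R).
  by apply: cvg_expr; rewrite ger0_norm ?ltW.
rewrite subr_gt0 => /(_ q_lt1)[k _ /(_ k (leqnn k))].
rewrite /= sub0r normrN ger0_norm // => qk.
rewrite (qpoch_infM k) ?x0 ?ltW // mulr_gt0 //.
  by apply: prodr_gt0 => i _; rewrite subr_gt0 (le_lt_trans _ x1) // ler_piMr.
have xqk : x * q ^+ k < 1 - q by rewrite (le_lt_trans _ qk) // ler_piMl // ltW.
have xqk01 : 0 <= x * q ^+ k <= 1.
  by rewrite mulr_ge0 //= ltW // (lt_trans xqk) // gtrBl.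
apply: (@lt_le_trans _ _ (1 - x * q ^+ k / (1 - q))).
  by rewrite subr_gt0 ltr_pdivrMr ?subr_gt0 // mul1r.
apply: limr_ge; first exact: qpoch_cvgn xqk01.
by apply: nearW => n; exact: qpoch_ge1B.
Qed.

Variable a : nat.

(* The factor [x] that raises [a] to [a.+1] is that of the Jackson measure. *)
Definition qLaguerre_weight (x : R) : R := x ^+ a.+1 * qpoch_inf (q * x) q.

Lemma qLaguerre_weight_ge0 k : 0 <= qLaguerre_weight (q ^+ k).
Proof.
apply: mulr_ge0; first by rewrite exprn_ge0.
by rewrite qpoch_inf_ge0 // -exprS qX_ge0 /=.
Qed.

Lemma qLaguerre_weight_le k : qLaguerre_weight (q ^+ k) <= q ^+ k.
Proof.
have qSk01 : 0 <= q * q ^+ k <= 1 by rewrite -exprS qX_ge0 /=.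
rewrite /qLaguerre_weight exprSr mulrAC ler_piMl // mulr_ile1 //.
- exact: exprn_ge0.
- exact: qpoch_inf_ge0.
- exact: exprn_ile1.
- exact: qpoch_inf_le1.
Qed.

Lemma qLaguerre_weight_pearson k :
  (1 - q ^+ k.+1) * qLaguerre_weight (q ^+ k.+1) =
  q ^+ a.+1 * qLaguerre_weight (q ^+ k).
Proof.
have -> : qLaguerre_weight (q ^+ k) =
    (q ^+ k) ^+ a.+1 * ((1 - q ^+ k.+1) * qpoch_inf (q * q ^+ k.+1) q).
  rewrite /qLaguerre_weight -exprS (qpoch_infM 1) ?qX_ge0 //=.
  by rewrite qpochS qpoch0 mulr1 expr1 [q * _]mulrC.
by rewrite /qLaguerre_weight [q ^+ k.+1]exprS exprMn; ring.
Qed.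

Definition qLaguerre_moment_trunc (K n : nat) : R :=
  \sum_(k < K) (q ^+ k) ^+ n * qLaguerre_weight (q ^+ k).

Definition qLaguerre_moment (n : nat) : R :=
  limn (qLaguerre_moment_trunc ^~ n).

Let trunc_nondec n :
  {homo qLaguerre_moment_trunc ^~ n : K L / (K <= L)%N >-> K <= L}.
Proof.
apply/nondecreasing_seqP => K; rewrite /qLaguerre_moment_trunc big_ord_recr /=.
by rewrite lerDl mulr_ge0 ?qLaguerre_weight_ge0 // exprn_ge0.
Qed.

Lemma qLaguerre_moment_trunc_cvgn n :
  qLaguerre_moment_trunc K n @[K --> \oo] --> qLaguerre_moment n.
Proof.
apply: nondecreasing_is_cvgn; first exact: trunc_nondec.
exists (1 - q)^-1 => _ [K _ <-].
apply: (@le_trans _ _ (\sum_(k < K) q ^+ k)).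
  apply: ler_sum => k _; rewrite (le_trans _ (qLaguerre_weight_le k)) //.
  by rewrite ler_piMl ?qLaguerre_weight_ge0 // exprn_ile1.
exact: geometric_sum_le.
Qed.

(* Summation by parts with the Pearson equation of the weight. *)
Lemma qLaguerre_momentS n :
  qLaguerre_moment n.+1 = (1 - q ^+ (a.+1 + n)) * qLaguerre_moment n.
Proof.
have truncB K :
    qLaguerre_moment_trunc K.+1 n - qLaguerre_moment_trunc K.+1 n.+1 =
    q ^+ (a.+1 + n) * qLaguerre_moment_trunc K n.
  rewrite /qLaguerre_moment_trunc -sumrB big_ord_recl /= !expr1n subrr add0r.
  rewrite big_distrr; apply: eq_bigr => k _ /=; rewrite /bump /= add1n.
  set w := qLaguerre_weight (q ^+ k.+1).
  transitivity ((q ^+ k.+1) ^+ n * ((1 - q ^+ k.+1) * w)).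
    by rewrite [(q ^+ k.+1) ^+ n.+1]exprSr; ring.
  by rewrite qLaguerre_weight_pearson [q ^+ k.+1]exprS exprMn exprD; ring.
apply/cvg_lim => //; rewrite -cvg_shiftS.
have -> : (fun K => qLaguerre_moment_trunc K.+1 n.+1) =
    (fun K => qLaguerre_moment_trunc K.+1 n -
              q ^+ (a.+1 + n) * qLaguerre_moment_trunc K n).
  by apply/funext => K; rewrite -truncB subKr.
rewrite mulrBl mul1r; apply: cvgB.
  rewrite (cvg_shiftS (qLaguerre_moment_trunc ^~ n)).
  exact: qLaguerre_moment_trunc_cvgn.
by apply: cvgMl_tmp; exact: qLaguerre_moment_trunc_cvgn.
Qed.

Lemma qLaguerre_momentE n :
  qLaguerre_moment n = qLaguerre_moment 0 * qpoch (q ^+ a.+1) q n.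
Proof.
elim: n => [|n IH]; first by rewrite qpoch0 mulr1.
by rewrite qLaguerre_momentS IH qpochSr exprD mulrC mulrA.
Qed.

Lemma qLaguerre_moment0_gt0 : 0 < qLaguerre_moment 0.
Proof.
apply: (@lt_le_trans _ _ (qLaguerre_moment_trunc 1 0)).
  rewrite /qLaguerre_moment_trunc big_ord1 mul1r mulr_gt0 ?exprn_gt0 //.
  by rewrite qpoch_inf_gt0 // mulr1 q_lt1 ltW.
apply: (@nondecreasing_cvgn_le _ (qLaguerre_moment_trunc ^~ 0%N)).
  exact: trunc_nondec.
exact: qLaguerre_moment_trunc_cvgn.
Qed.

End LittleQLaguerre.

(** * The spectral moments at finite size *)

Lemma cvg_det (K : numFieldType) (T : Type) (F : set_system T) (FF : Filter F)
    (n : nat) (f : T -> 'M[K]_n) (M : 'M[K]_n) :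
  (forall i j, f x i j @[x --> F] --> M i j)%classic ->
  (\det (f x) @[x --> F] --> \det M)%classic.
Proof.
move=> fM; apply: cvg_big => [|s _]; first exact: add_continuous.
apply: cvgMl_tmp; apply: cvg_big => [|i _]; first exact: mul_continuous.
exact: fM.
Qed.

Section FiniteSize.
Local Open Scope classical_set_scope.
Variables (R : realType) (q : R) (a : nat).
Hypotheses (q_gt0 : 0 < q) (q_lt1 : q < 1).

Lemma qLUE_weightE (N : nat) (x : 'I_N -> R) :
  qLUE_weight a q x = diff_prod x ^+ 2 * \prod_j qLaguerre_weight q a (x j).
Proof.
rewrite /qLUE_weight -prodrXl; congr (_ * _).
  apply: eq_bigr => i _; rewrite -prodrXl; apply: eq_bigr => j _.
  by rewrite -sqrrN opprB.
by apply: eq_bigr => j _; rewrite /qLaguerre_weight exprSr mulrAC.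
Qed.

Lemma qLUE_trunc_mass (N K : nat) :
  @qLUE_trunc R N a q (fun _ => 1) K =
  N`!%:R * hankel_det (qLaguerre_moment_trunc q a K) (@nat_of_ord N).
Proof.
rewrite -[RHS](sum_diff_prod_sqr N (fun k : 'I_K => q ^+ k)
  (fun k => qLaguerre_weight q a (q ^+ k))).
by apply: eq_bigr => k _; rewrite mul1r qLUE_weightE.
Qed.

Lemma qLUE_trunc_power_sum (N p K : nat) :
  @qLUE_trunc R N a q (fun x => \sum_(j < N) x j ^+ p) K =
  N`!%:R *
  \sum_(i < N) hankel_det (qLaguerre_moment_trunc q a K) (raise_at i p).
Proof.
rewrite -[RHS](sum_power_sum_diff_prod_sqr N (fun k : 'I_K => q ^+ k)
  (fun k => qLaguerre_weight q a (q ^+ k))).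
by apply: eq_bigr => k _; rewrite qLUE_weightE.
Qed.

Lemma qLUE_moment_hankel (N p : nat) :
  qLUE_moment N a q p =
  (\sum_(i < N) hankel_det (qLaguerre_moment q a) (raise_at i p)) /
  hankel_det (qLaguerre_moment q a) (@nat_of_ord N).
Proof.
have hankel_cvg (l : 'I_N -> nat) :
    hankel_det (qLaguerre_moment_trunc q a K) l @[K --> \oo] -->
    hankel_det (qLaguerre_moment q a) l.
  apply: cvg_det => i j; under eq_fun do rewrite mxE; rewrite mxE.
  exact: qLaguerre_moment_trunc_cvgn.
have mass_cvg :
    N`!%:R * hankel_det (qLaguerre_moment_trunc q a K) (@nat_of_ord N)
    @[K --> \oo] -->
    N`!%:R * hankel_det (qLaguerre_moment q a) (@nat_of_ord N).
  by apply: cvgMl_tmp; exact: hankel_cvg.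
have power_sum_cvg :
    N`!%:R *
    (\sum_(i < N) hankel_det (qLaguerre_moment_trunc q a K) (raise_at i p))
    @[K --> \oo] -->
    N`!%:R * \sum_(i < N) hankel_det (qLaguerre_moment q a) (raise_at i p).
  apply: cvgMl_tmp; apply: cvg_big => [|i _]; first exact: add_continuous.
  exact: hankel_cvg.
rewrite /qLUE_moment (funext (qLUE_trunc_mass N)).
rewrite (funext (qLUE_trunc_power_sum N p)).
rewrite (cvg_lim _ mass_cvg) // (cvg_lim _ power_sum_cvg) //.
by rewrite -mulf_div divff ?mul1r // pnatr_eq0 -lt0n fact_gt0.
Qed.

Lemma qLUE_moment_resummed (N n : nat) : (n < N)%N ->
  qLUE_moment N a q n.+1 =
  (qbinom_transform q n
     (qpoch_poly q 1 n.+1 * qpoch_poly q (q ^+ a) n.+1)).[q ^+ N] /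
  (1 - q ^+ n.+1).
Proof.
move=> nN; have q_neq0 : q != 0 by rewrite gt_eqF.
have oneBqX_neq0 k : 1 - q ^+ k.+1 != 0.
  by rewrite gt_eqF // subr_gt0 exprn_ilt1 ?ltW.
rewrite qLUE_moment_hankel -sum_qpoch_ratio // big_distrl.
apply: eq_bigr => i _ /=.
have -> : qLaguerre_moment q a =
    (fun n => qLaguerre_moment q a 0 * qpoch (q ^+ a.+1) q n).
  by apply/funext => k; exact: qLaguerre_momentE.
have qX_neq0 k : q ^+ k != 0 by rewrite expf_neq0.
have oneBqaX_neq0 k : 1 - q ^+ a.+1 * q ^+ k != 0 by rewrite -exprD addSn.
rewrite !hankel_detZ hankel_det_qpoch_raise // -!exprD addSnnS.
rewrite [X in X / _]mulrA [LHS]mulrC mulKf //.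
rewrite mulf_neq0 ?hankel_det_qpoch_neq0 //.
by rewrite expf_neq0 // gt_eqF // qLaguerre_moment0_gt0.
Qed.

End FiniteSize.

(** * The incomplete beta function *)

(* The limit of [qbinom_weight q n j] as [q] tends to [1]. *)
Definition binom_weight (F : fieldType) (n j : nat) : F :=
  \prod_(t < n) ((t.+1%:R - j%:R) / t.+1%:R).

Notation binom_transform n := (scale_coef (binom_weight _ n)).

Section IncompleteBeta.
Variable R : realType.
Implicit Types (n m j : nat) (P : {poly R}) (s : R).

Let fact_neq0 n : n`!%:R != 0 :> R.
Proof. by rewrite pnatr_eq0 -lt0n fact_gt0. Qed.

Let beta_fun_neq0 m n : beta_fun m n != 0 :> R.
Proof. by rewrite gt_eqF // beta_fun_gt0. Qed.

Lemma binom_weight0 n : binom_weight R n 0 = 1.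
Proof. by apply: big1 => t _; rewrite subr0 divff ?pnatr_eq0. Qed.

Lemma binom_weightS n j :
  binom_weight R n j.+1 = (-1) ^+ n * (j ^_ n)%:R / n`!%:R.
Proof.
elim: n => [|n IH]; first by rewrite /binom_weight big_ord0 !expr0 divr1 mulr1.
rewrite /binom_weight big_ord_recr /= -/(binom_weight R n j.+1) IH.
rewrite factS natrM exprS ffactnSr natrM.
case: (ltnP j n) => [ltjn|lenj].
  by rewrite ffact_small // !(mul0r, mulr0).
rewrite natrB // -[n.+1%:R]natr1 -[j.+1%:R]natr1.
by field; rewrite fact_neq0 natr1 pnatr_eq0.
Qed.

Lemma deriv_binom_transform n P :
  (binom_transform n P)^`() =
  ((-1) ^+ n / n`!%:R) *: ('X^n * P^`(n.+1)).
Proof.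
apply/polyP => i; rewrite coef_deriv coef_scale_coef coefZ coefXnM coef_derivn.
rewrite binom_weightS; case: ltnP => [ltin|leni].
  by rewrite ffact_small // !(mul0r, mulr0) mul0rn.
rewrite addSn subnKC // ffactSS -[LHS]mulr_natl -[P`__ *+ _]mulr_natl natrM.
by ring.
Qed.

Lemma derivn_1subX_expn n m :
  (((1 - 'X) ^+ (n + m))^`(n) : {poly R}) =
  ((-1) ^+ n * ((n + m) ^_ n)%:R) *: (1 - 'X) ^+ m.
Proof.
elim: n m => [|n IH] m; first by rewrite derivn0 expr0 mulr1 scale1r.
rewrite derivnS addSnnS IH derivZ deriv_exp derivB derivC derivX sub0r /=.
rewrite ffactnSr addKn natrM exprS !mulN1r.
rewrite -[(- _) *+ _]scaler_nat -[- ((1 - 'X) ^+ m)]scaleN1r !scalerA.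
by congr (_ *: _); ring.
Qed.

Lemma beta_funV m n :
  (beta_fun m.+1 n.+1 : R)^-1 = (n.+1 * 'C((m + n).+1, n.+1))%:R.
Proof.
have := bin_fact (leq_addl m n.+1); rewrite addnK addnS => binE.
rewrite beta_fun_fact invf_div -binE factS !natrM.
by field; rewrite !fact_neq0.
Qed.

Lemma deriv_binom_transform_1subX n m :
  (binom_transform n ((1 - 'X) ^+ (n.+1 + m)))^`() =
  - (beta_fun m.+1 n.+1)^-1 *: ('X^n * (1 - 'X) ^+ m) :> {poly R}.
Proof.
rewrite deriv_binom_transform derivn_1subX_expn -scalerAr scalerA.
congr (_ *: _); rewrite beta_funV addnC addnS -bin_ffact factS !natrM.
rewrite exprS mulrACA [X in X * _]mulrCA -expr2 sqrr_sign.
by field.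
Qed.

Lemma Rintegral_deriv_poly P (a b : R) : a < b ->
  (\int[lebesgue_measure]_(t in `[a, b]) P^`().[t])%R = P.[b] - P.[a].
Proof.
move=> ab; rewrite /Rintegral (@continuous_FTC2 _ _ (horner P)) //=.
- by apply/continuous_subspaceT => t; exact: continuous_horner.
- split=> [t _| |]; first exact: derivable_horner.
  + by apply: cvg_at_right_filter; exact: continuous_horner.
  + by apply: cvg_at_left_filter; exact: continuous_horner.
- by move=> t _; rewrite -derivE.
Qed.

Lemma Rintegral_beta_kernel n m s : 0 < s ->
  (\int[lebesgue_measure]_(t in `[0%R, s]) (t ^+ m * (1 - t) ^+ n))%R =
  beta_fun m.+1 n.+1 *
  ((binom_transform n ((1 - 'X) ^+ (n.+1 + m))).[1 - s] -
   (binom_transform n ((1 - 'X) ^+ (n.+1 + m))).[1]).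
Proof.
move=> s0; set Q := scale_coef _ _.
pose P : {poly R} := beta_fun m.+1 n.+1 *: (Q \Po (1 - 'X)).
have PE t : P.[t] = beta_fun m.+1 n.+1 * Q.[1 - t].
  by rewrite !hornerE horner_comp !hornerE.
have P'E t : P^`().[t] = t ^+ m * (1 - t) ^+ n.
  rewrite derivZ deriv_comp derivB derivC derivX sub0r.
  rewrite deriv_binom_transform_1subX !hornerE horner_comp !hornerE /=.
  by rewrite opprB addrCA subrr addr0; field.
under eq_Rintegral do rewrite -P'E.
by rewrite Rintegral_deriv_poly // !PE subr0 mulrBr.
Qed.

Lemma betaincE n m s : s < 1 ->
  betainc (1 - s) m.+1 n.+1 =
  (binom_transform n ((1 - 'X) ^+ (n.+1 + m))).[s].
Proof.
move=> s1; set Q := scale_coef _ _.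
have Q0 : Q.[0] = 1.
  rewrite horner_coef0 coef_scale_coef binom_weight0 mul1r -horner_coef0.
  by rewrite !hornerE subr0 expr1n.
have Q1 : Q.[1] = 0.
  have : beta_fun m.+1 n.+1 * (Q.[0] - Q.[1]) = beta_fun m.+1 n.+1.
    rewrite -[X in Q.[X] - _](subrr 1) -Rintegral_beta_kernel //.
    by rewrite /beta_fun -Rintegral_mkcond.
  move/(canRL (mulKf (beta_fun_neq0 _ _))); rewrite mulVf // Q0; lra.
rewrite /betainc Rintegral_beta_kernel ?subr_gt0 // -/Q Q1 subr0 mulrC mulKf //.
by rewrite opprB addrC subrK.
Qed.

Lemma horner_binom_transform n p (x s : R) : s < 1 ->
  (binom_transform n ((1 - 'X) ^+ n.+1 * (1 - x *: 'X) ^+ p)).[s] =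
  \sum_(m < p.+1) 'C(p, m)%:R * x ^+ m * (1 - x) ^+ (p - m) *
                  betainc (1 - s) m.+1 n.+1.
Proof.
move=> s1.
have -> : 1 - x *: 'X = (1 - x)%:P + x *: (1 - 'X) :> {poly R}.
  by rewrite -!mul_polyC polyCB; ring.
rewrite [(_%:P + _) ^+ p]exprDn big_distrr /= scale_coef_sum horner_sum.
apply: eq_bigr => m _; rewrite betaincE // exprZn -polyC_exp mul_polyC scalerA.
rewrite -scaler_nat scalerA -scalerAr -exprD scale_coefZ hornerZ.
by congr (_ * _); ring.
Qed.

End IncompleteBeta.

(** * First-order expansions at 0 *)

Lemma cvg_eqO1 (R : realType) (T : Type) (F : filter_on T) (f : T -> R)
    (l : R) :
  (f x @[x --> F] --> l)%classic -> f =O_F (cst 1 : T -> R).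
Proof.
move=> /cvgrPdist_le/(_ 1 ltr01) fl; apply/eqO_exP.
exists (`|l| + 1); first by rewrite ltr_wpDl.
apply: filterS fl => x fl; rewrite normr1 mulr1 -[f x](subrK l) addrC.
by apply: le_trans (ler_normD _ _) _; rewrite lerD2l distrC.
Qed.

Lemma eqOM_bounded (R : realType) (T : pointedType) (F : filter_on T)
    (e f g : T -> R) :
  f =O_F e -> g =O_F (cst 1 : T -> R) -> f * g =O_F e.
Proof.
move=> -> ->; rewrite (mulO (R := R)).
have -> // : e * cst 1 = e :> (T -> R).
exact: mulr1.
Qed.

Section AffineExpansion.
Local Open Scope classical_set_scope.
Variable R : realType.
Implicit Types (f g : R -> R) (a b c : R).

Definition affine_expansion f a b : Prop :=
  (fun h => f h - (a + b * h)) =O_ (0^') (fun h => h ^+ 2).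

Lemma affine_expansionP f a b : affine_expansion f a b <->
  exists2 k, 0 < k & \forall h \near 0^', `|f h - (a + b * h)| <= k * h ^+ 2.
Proof.
have norm_sqr (h : R) : `|h ^+ 2| = h ^+ 2 by rewrite ger0_norm ?sqr_ge0.
rewrite /affine_expansion eqO_exP.
by split=> -[k k0 fk]; exists k => //; apply: filterS fk => x; rewrite norm_sqr.
Qed.

Lemma affine_expansion_near f g a b : affine_expansion f a b ->
  (\forall h \near 0^', f h = g h) -> affine_expansion g a b.
Proof.
move=> /affine_expansionP[k k0 fk] fg; apply/affine_expansionP.
by exists k => //; apply: filterS2 fg fk => h ->.
Qed.

Lemma affine_expansion_eq f g a b a' b' : affine_expansion f a b ->
  (forall h, h != 0 -> f h = g h) -> a = a' -> b = b' ->
  affine_expansion g a' b'.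
Proof.
move=> fE fg <- <-; apply: affine_expansion_near fE _.
exact: filterS fg (nbhs_dnbhs_neq (0 : R)).
Qed.

Lemma affine_expansion_affine a b : affine_expansion (fun h => a + b * h) a b.
Proof.
apply/affine_expansionP; exists 1 => //; apply: nearW => h.
by rewrite subrr normr0 mul1r sqr_ge0.
Qed.

Lemma affine_expansion_cst a : affine_expansion (cst a) a 0.
Proof.
apply: affine_expansion_eq (affine_expansion_affine a 0) _ erefl erefl => h _.
by rewrite mul0r addr0.
Qed.

Lemma affine_expansionD f g a b a' b' :
  affine_expansion f a b -> affine_expansion g a' b' ->
  affine_expansion (fun h => f h + g h) (a + a') (b + b').
Proof.
move=> fE gE; rewrite /affine_expansion.
have -> : (fun h => f h + g h - (a + a' + (b + b') * h)) =
    (fun h => f h - (a + b * h)) + (fun h => g h - (a' + b' * h)).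
  by apply/funext => h; rewrite fctE; ring.
exact: add2O.
Qed.

Lemma affine_expansion_cvg f a b : affine_expansion f a b ->
  f h @[h --> 0^'] --> a.
Proof.
move=> /affine_expansionP[k k0 fk].
have id0 : h @[h --> (0 : R)^'] --> (0 : R) by exact: nbhs_dnbhs.
have affine_cvg : a + b * h @[h --> 0^'] --> a + b * 0.
  by apply: cvgD; [exact: cvg_cst | exact: cvgMl_tmp].
have sqr_cvg : k * h ^+ 2 @[h --> 0^'] --> k * (0 * 0).
  by under eq_fun do rewrite expr2; apply: cvgMl_tmp; exact: cvgM.
rewrite !mulr0 addr0 in affine_cvg sqr_cvg.
have rem_cvg : f h - (a + b * h) @[h --> 0^'] --> (0 : R).
  apply: norm_cvg0; apply: squeeze_cvgr (cvg_cst 0) sqr_cvg.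
  by apply: filterS fk => h; rewrite normr_ge0.
rewrite -[a]add0r; under eq_fun => h do rewrite -[f h](subrK (a + b * h)).
exact: cvgD.
Qed.

Lemma affine_expansionM f g a b a' b' :
  affine_expansion f a b -> affine_expansion g a' b' ->
  affine_expansion (fun h => f h * g h) (a * a') (a * b' + b * a').
Proof.
move=> fE gE; rewrite /affine_expansion.
have -> : (fun h => f h * g h - (a * a' + (a * b' + b * a') * h)) =
    (fun h => f h - (a + b * h)) * g +
    ((fun h => g h - (a' + b' * h)) * (fun h => a + b * h) +
    (fun h => h ^+ 2) * cst (b * b')).
  by apply/funext => h; rewrite !fctE; ring.
apply: add2O; last apply: add2O; apply: eqOM_bounded => //.
- exact: cvg_eqO1 (affine_expansion_cvg gE).
- exact: cvg_eqO1 (affine_expansion_cvg (affine_expansion_affine a b)).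
- exact: idO.
- exact: cvg_eqO1 (cvg_cst _).
Qed.

Lemma affine_expansionV f a b : a != 0 -> affine_expansion f a b ->
  affine_expansion (fun h => (f h)^-1) a^-1 (- b / a ^+ 2).
Proof.
move=> a0 fE; set b' : R := - b / a ^+ 2.
have fVO : (fun h => (f h)^-1%R) =O_ (0^') (cst 1 : R -> R).
  exact: cvg_eqO1 (cvgV a0 (affine_expansion_cvg fE)).
pose u (h : R) : R := a^-1 + b' * h.
have fuE : affine_expansion (fun h => f h * u h) 1 0.
  have := affine_expansionM fE (affine_expansion_affine a^-1 b').
  move/affine_expansion_eq; apply.
  - by [].
  - exact: mulfV.
  - by rewrite /b'; field.
have fV_exact : affine_expansion
    (fun h => u h - (f h * u h - (1 + 0 * h)) * (f h)^-1) a^-1 b'.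
  rewrite /affine_expansion.
  have -> : (fun h => u h - (f h * u h - (1 + 0 * h)) * (f h)^-1 -
      (a^-1 + b' * h)) =
      - ((fun h => f h * u h - (1 + 0 * h)) * (fun h => (f h)^-1)).
    by apply/funext => h; rewrite !fctE /u; ring.
  exact/oppfO/eqOM_bounded.
apply: affine_expansion_near fV_exact _.
apply: filterS (cvgr_neq0 _ (affine_expansion_cvg fE) a0) => h f_neq0.
by field.
Qed.

Lemma affine_expansion_sum (I : Type) (s : seq I) (f : I -> R -> R)
    (a b : I -> R) :
  (forall i, affine_expansion (f i) (a i) (b i)) ->
  affine_expansion (fun h => \sum_(i <- s) f i h)
    (\sum_(i <- s) a i) (\sum_(i <- s) b i).
Proof.
move=> fE; elim: s => [|i s IH].
  rewrite !big_nil; under eq_fun do rewrite big_nil.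
  exact: affine_expansion_cst.
rewrite !big_cons; under eq_fun do rewrite big_cons.
exact: affine_expansionD.
Qed.

Lemma cvg_inv_nat_dnbhs : (N%:R^-1 : R) @[N --> \oo] --> (0 : R)^'.
Proof.
have N_gt0 : \forall N \near \oo, 0 < N%:R :> R.
  by exists 1%N => // N N0; rewrite ltr0n.
have cvg0 : (N%:R^-1 : R) @[N --> \oo] --> (0 : R).
  by rewrite gtr0_cvgV0 //; exact: cvgr_idn.
move=> A /cvg0 invA; apply: filterS2 N_gt0 invA => N N0; apply.
by rewrite invr_neq0 // gt_eqF.
Qed.

Lemma affine_expansion_nat f a b : affine_expansion f a b ->
  exists C : R, exists N0 : nat, forall N : nat, (N0 <= N)%N ->
    `|N%:R * f N%:R^-1 - (N%:R * a + b)| <= C / N%:R.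
Proof.
move=> /affine_expansionP[C C0 /cvg_inv_nat_dnbhs[N0 _ fC]].
exists C, (maxn 1 N0) => N; rewrite geq_max => /andP[N_gt0 N0N].
have Npos : 0 < N%:R :> R by rewrite ltr0n.
have -> : N%:R * f N%:R^-1 - (N%:R * a + b) =
    N%:R * (f N%:R^-1 - (a + b * N%:R^-1)) by field; rewrite gt_eqF.
rewrite normrM gtr0_norm // mulrC -ler_pdivlMr //.
by apply: le_trans (fC N N0N) _; rewrite exprVn expr2 invfM mulrA.
Qed.

End AffineExpansion.

Section ExponentialExpansion.
Local Open Scope classical_set_scope.
Variable R : realType.
Implicit Types (x c : R).

Lemma expR_taylor_le x n :
  `|expR x - \sum_(k < n) x ^+ k / k`!%:R| <= `|x| ^+ n * expR `|x|.
Proof.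
have tail_le j :
    `|series (exp_coeff x) (j + n)%N - \sum_(k < n) x ^+ k / k`!%:R| <=
    `|x| ^+ n * expR `|x|.
  rewrite /series /exp_coeff /= big_mkord addnC big_split_ord /=.
  rewrite addrAC subrr add0r.
  apply: le_trans (ler_norm_sum _ _ _) _.
  apply: (@le_trans _ _ (`|x| ^+ n * series (exp_coeff `|x|) j)).
    rewrite /series /= big_mkord big_distrr; apply: ler_sum => k _ /=.
    rewrite /exp_coeff /= normrM normrX exprD -mulrA normfV normr_nat.
    rewrite !ler_wpM2l ?exprn_ge0 // lef_pV2 ?posrE ?ltr0n ?fact_gt0 //.
    by rewrite ler_nat leq_fact // leq_addl.
  rewrite ler_wpM2l ?exprn_ge0 //.
  apply: nondecreasing_cvgn_le; last exact: is_cvg_series_exp_coeff.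
  by apply: nondecreasing_series => k _ _; exact: exp_coeff_ge0.
have tail_cvg : series (exp_coeff x) (j + n)%N - \sum_(k < n) x ^+ k / k`!%:R
    @[j --> \oo] --> expR x - \sum_(k < n) x ^+ k / k`!%:R.
  apply: cvgB; last exact: cvg_cst.
  rewrite (cvg_shiftn n (series (exp_coeff x))).
  exact: is_cvg_series_exp_coeff.
by apply: (cvgr_to_le (cvg_norm tail_cvg)); exact: nearW.
Qed.

Lemma affine_expansion_oneB_expR c :
  affine_expansion (fun h => (1 - expR (- c * h)) / h) c (- c ^+ 2 / 2).
Proof.
apply/affine_expansionP.
exists (`|c| ^+ 3 * expR `|c| + 1).
  by rewrite ltr_wpDl // mulr_ge0 ?exprn_ge0 ?expR_ge0.
have norm_le1 : \forall h \near (0 : R)^', `|h| <= 1 := dnbhs0_le ltr01.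
apply: filterS2 (nbhs_dnbhs_neq (0 : R)) norm_le1 => h h_neq0 h_le1.
pose rem := expR (- c * h) - (1 + - c * h + (- c * h) ^+ 2 / 2).
have remE : (1 - expR (- c * h)) / h - (c + - c ^+ 2 / 2 * h) = - rem / h.
  by rewrite /rem; field.
have rem_le : `|rem| <= `|c| ^+ 3 * expR `|c| * `|h| ^+ 3.
  have := expR_taylor_le (- c * h) 3.
  rewrite 3!big_ord_recr big_ord0 /= add0r !divr1 expr0 expr1.
  move/le_trans; apply; rewrite normrM normrN exprMn mulrAC.
  rewrite ler_wpM2r ?exprn_ge0 //.
  by rewrite ler_wpM2l ?exprn_ge0 // ler_expR ler_piMr.
rewrite remE normrM normrN normfV ler_pdivrMr ?normr_gt0 //.
apply: le_trans rem_le _; rewrite -[h ^+ 2]real_normK ?num_real //.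
by rewrite -[leRHS]mulrA -exprSr ler_wpM2r ?exprn_ge0 // lerDl.
Qed.

Lemma affine_expansion_expR c :
  affine_expansion (fun h => expR (- c * h)) 1 (- c).
Proof.
have := affine_expansionM (affine_expansion_affine 0 (-1))
  (affine_expansion_oneB_expR c).
move=> /(affine_expansionD (affine_expansion_cst 1))/affine_expansion_eq; apply.
- by move=> h h0 /=; rewrite add0r; field.
- by rewrite mul0r addr0.
- by ring.
Qed.

End ExponentialExpansion.

(** * Expansion of the moments *)

Section PolyExpansion.
Variable R : realType.
Implicit Types (P Q : R -> {poly R}) (A B C D : {poly R}).

Definition poly_expansion P A B : Prop :=
  forall j, affine_expansion (fun h => (P h)`_j) A`_j B`_j.

Lemma poly_expansionM P Q A B C D :
  poly_expansion P A B -> poly_expansion Q C D ->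
  poly_expansion (fun h => P h * Q h) (A * C) (A * D + B * C).
Proof.
move=> PE QE j.
have coefME (i : 'I_j.+1) := affine_expansionM (PE i) (QE (j - i)%N).
apply: affine_expansion_eq (affine_expansion_sum (index_enum _) coefME) _ _ _.
- by move=> h _; rewrite coefM.
- by rewrite coefM.
- by rewrite coefD !coefM -big_split.
Qed.

Lemma poly_expansion_oneBZX f (a b : R) : affine_expansion f a b ->
  poly_expansion (fun h => 1 - f h *: 'X) (1 - a *: 'X) (- b *: 'X).
Proof.
move=> fE j.
have := affine_expansionM (affine_expansion_cst (- ('X : {poly R})`_j)) fE.
move=> /(affine_expansionD (affine_expansion_cst (1 : {poly R})`_j)).
move/affine_expansion_eq; apply.
- by move=> h _; rewrite coefB coefZ /=; ring.
- by rewrite coefB coefZ; ring.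
- by rewrite coefZ; ring.
Qed.

Lemma poly_expansion_scale_coef (w : R -> nat -> R) (w0 w1 : nat -> R) P A B :
  (forall j, affine_expansion (w^~ j) (w0 j) (w1 j)) -> poly_expansion P A B ->
  poly_expansion (fun h => scale_coef (w h) (P h))
    (scale_coef w0 A) (scale_coef w0 B + scale_coef w1 A).
Proof.
move=> wE PE j.
apply: affine_expansion_eq (affine_expansionM (wE j) (PE j)) _ _ _.
- by move=> h _; rewrite coef_scale_coef.
- by rewrite coef_scale_coef.
- by rewrite coefD !coef_scale_coef.
Qed.

Lemma poly_expansion_horner P A B (K : nat) (x : R) :
  (forall h, (size (P h) <= K)%N) -> poly_expansion P A B ->
  affine_expansion (fun h => (P h).[x]) A.[x] B.[x].
Proof.
move=> szP PE; pose L := maxn K (maxn (size A) (size B)).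
have termE (j : 'I_L) :=
  affine_expansionM (PE j) (affine_expansion_cst (x ^+ j)).
have szA : (size A <= L)%N by rewrite !leq_max leqnn orbT.
have szB : (size B <= L)%N by rewrite !leq_max leqnn !orbT.
apply: affine_expansion_eq (affine_expansion_sum (index_enum _) termE) _ _ _.
- move=> h _; rewrite (@horner_coef_wide _ L) //.
  exact: leq_trans (szP h) (leq_maxl _ _).
- by rewrite (horner_coef_wide _ szA).
- by rewrite (horner_coef_wide _ szB); under eq_bigr do rewrite mulr0 add0r.
Qed.

End PolyExpansion.

Lemma deriv_oneBZX_exp (R : comNzRingType) (s : R) (k : nat) :
  ((1 - s *: 'X) ^+ k.+1)^`() = - (k.+1%:R * s) *: (1 - s *: 'X) ^+ k.
Proof.
rewrite deriv_exp derivB -polyC1 derivC derivZ derivX sub0r -polyC1.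
by rewrite mulNr -scalerAl mul1r -scaler_nat scalerN scalerA -scaleNr.
Qed.

Lemma deriv_oneBZX_expM (R : comNzRingType) (s : R) (k : nat) :
  ((1 - s *: 'X) ^+ k)^`() * (1 - s *: 'X) = - (k%:R * s) *: (1 - s *: 'X) ^+ k.
Proof.
case: k => [|k]; first by rewrite expr0 -polyC1 derivC !mul0r oppr0 scale0r.
by rewrite deriv_oneBZX_exp -scalerAl -exprSr.
Qed.

Section MomentExpansion.
Variables (R : realType) (lam : R).
Hypothesis lam_gt0 : 0 < lam.

Let q (h : R) : R := expR (- lam * h).

Let lam_neq0 : lam != 0. Proof. by rewrite gt_eqF. Qed.

Lemma q_ratio_expansion (v j : nat) : (0 < v)%N ->
  affine_expansion (fun h => (1 - q h ^+ v / q h ^+ j) / (1 - q h ^+ v))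
    ((v%:R - j%:R) / v%:R) (lam / 2 * j%:R * ((v%:R - j%:R) / v%:R)).
Proof.
move=> v_gt0; have v_neq0 : v%:R != 0 :> R by rewrite pnatr_eq0 -lt0n.
have lamv_neq0 : lam * v%:R != 0 by rewrite mulf_neq0.
have := affine_expansionM (affine_expansion_oneB_expR (lam * (v%:R - j%:R)))
  (affine_expansionV lamv_neq0 (affine_expansion_oneB_expR (lam * v%:R))).
move/affine_expansion_eq; apply.
- move=> h h_neq0; rewrite /q -!expRM_natr -expRB invf_div mulrA divfK //.
  by congr ((1 - expR _) / (1 - expR _)); ring.
- by field; rewrite v_neq0 lam_neq0.
- by field; rewrite v_neq0 lam_neq0.
Qed.

Lemma qbinom_weight_expansion (n j : nat) :
  affine_expansion (fun h => qbinom_weight (q h) n j)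
    (binom_weight R n j) (n%:R * lam / 2 * j%:R * binom_weight R n j).
Proof.
elim: n => [|n IH].
  apply: affine_expansion_eq (affine_expansion_cst 1) _ _ _.
  - by move=> h _; rewrite /qbinom_weight !qpoch0 divr1.
  - by rewrite /binom_weight big_ord0.
  - by rewrite !mul0r.
have stepE := affine_expansionM IH (q_ratio_expansion j (ltn0Sn n)).
apply: affine_expansion_eq stepE _ _ _.
- move=> h _; rewrite /qbinom_weight !qpochSr -mulf_div.
  by rewrite [q h / _ * _]mulrAC -!exprS.
- by rewrite /binom_weight big_ord_recr.
- by rewrite /binom_weight big_ord_recr /= -natr1; ring.
Qed.

Lemma qpoch_poly_expansion (f : R -> R) (s d : R) (k : nat) :
  affine_expansion f s (- (lam * d * s)) ->
  poly_expansion (fun h => qpoch_poly (q h) (f h) k)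
    ((1 - s *: 'X) ^+ k)
    (- (lam * (d + (k%:R - 1) / 2)) *: ('X * ((1 - s *: 'X) ^+ k)^`())).
Proof.
move=> fE; elim: k => [|k IH].
  move=> j; rewrite expr0 -polyC1 derivC mulr0 scaler0 coef0.
  by under eq_fun do rewrite qpoch_poly0 -polyC1; exact: affine_expansion_cst.
have fqE : affine_expansion (fun h => f h * q h ^+ k) s
    (- (lam * (d + k%:R) * s)).
  have := affine_expansionM fE (affine_expansion_expR (lam * k%:R)).
  move/affine_expansion_eq; apply; rewrite ?mulr1 //; last by ring.
  by move=> h _; rewrite /q -expRM_natr; congr (_ * expR _); ring.
have prodE := poly_expansionM IH (poly_expansion_oneBZX fqE).
move=> j; apply: affine_expansion_eq (prodE j) _ _ _.
- by move=> h _; rewrite qpoch_polySr.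
- by rewrite exprSr.
- congr (_ : {poly R})`_j.
  rewrite -[_ *: (_ * _) * _]scalerAl -['X * _ * (_ - _)]mulrA.
  rewrite deriv_oneBZX_expM deriv_oneBZX_exp.
  rewrite -!scalerAr !scalerA [_ ^+ k * 'X]mulrC -scalerDl -natr1.
  by congr (_ *: _); field.
Qed.

(* The correction [lam / 2 * n * j] of the weights cancels those that the powers
   of [q] in the products [qpoch_poly] contribute: only [d] remains. *)
Lemma resummed_moment_expansion (f : R -> R) (s d x : R) (n : nat) :
  affine_expansion f s (- (lam * d * s)) ->
  affine_expansion
    (fun h => (qbinom_transform (q h) n
                 (qpoch_poly (q h) 1 n.+1 * qpoch_poly (q h) (f h) n.+1)).[x])
    (binom_transform n ((1 - 'X) ^+ n.+1 * (1 - s *: 'X) ^+ n.+1)).[x]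
    (- (lam * d) * (binom_transform n
       ('X * ((1 - 'X) ^+ n.+1 * ((1 - s *: 'X) ^+ n.+1)^`()))).[x]).
Proof.
move=> fE.
have oneE : affine_expansion (cst 1) 1 (- (lam * 0 * 1)).
  by rewrite mulr0 mul0r oppr0; exact: affine_expansion_cst.
have := poly_expansionM (qpoch_poly_expansion n.+1 oneE)
  (qpoch_poly_expansion n.+1 fE).
rewrite scale1r.
move=> /(poly_expansion_scale_coef (qbinom_weight_expansion n)) coefE.
have szG h : (size (qbinom_transform (q h) n
    (qpoch_poly (q h) 1 n.+1 * qpoch_poly (q h) (f h) n.+1)) <= n.+2 + n.+2)%N.
  rewrite (leq_trans (size_scale_coef_le _ _)) //.
  rewrite (leq_trans (size_polyMleq _ _)) //.
  by rewrite (leq_trans (leq_pred _)) // leq_add ?size_qpoch_poly_le.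
apply: affine_expansion_eq (poly_expansion_horner x szG coefE) _ erefl _ => //.
rewrite -hornerZ; congr (_.[x]); apply/polyP => j.
rewrite coefD coefZ !coef_scale_coef.
set A1 := (1 - 'X) ^+ n.+1; set A2 := (1 - s *: 'X) ^+ n.+1.
have indexE : j%:R * (A1 * A2)`_j =
    ('X * A1^`() * A2)`_j + (A1 * ('X * A2^`()))`_j.
  rewrite -mulrA [A1 * ('X * _)]mulrCA -coefD -mulrDr -derivM coefXM.
  by case: j => [|j]; rewrite ?mul0r // coef_deriv mulr_natl.
have -> : n%:R * lam / 2 * j%:R * binom_weight R n j * (A1 * A2)`_j =
    n%:R * lam / 2 * binom_weight R n j * (j%:R * (A1 * A2)`_j) by ring.
rewrite indexE ['X * (A1 * _)]mulrCA -scalerAl -scalerAr coefD !coefZ -natr1.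
by field.
Qed.

End MomentExpansion.

Section MomentProfile.
Variable R : realType.
Implicit Types (lam c d : R).

(* The value of [m_(N,p) / N], with [p = n.+1], as a function of [h = 1 / N]:
   then [q ^+ N = s], and [q ^+ a = s `^ c * expR (- (lam * d) * h)] when
   [a = c * N + d]. *)
Definition moment_profile lam c d (n : nat) (h : R) : R :=
  let q := expR (- lam * h) in let s := expR (- lam) in
  ((1 - q ^+ n.+1) / h)^-1 *
  (qbinom_transform q n
     (qpoch_poly q 1 n.+1 *
      qpoch_poly q (s `^ c * expR (- (lam * d) * h)) n.+1)).[s].

Lemma qLUE_moment_profileE lam c d (n N a : nat) : 0 < lam -> (n < N)%N ->
  c * N%:R + d = a%:R ->
  qLUE_moment N a (expR (- lam / N%:R)) n.+1 / N%:R =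
  moment_profile lam c d n N%:R^-1.
Proof.
move=> lam_gt0 nN aE.
have N_gt0 : 0 < N%:R :> R by rewrite ltr0n (leq_trans _ nN).
rewrite qLUE_moment_resummed ?expR_gt0 //; last first.
  by rewrite expR_lt1 mulNr oppr_lt0 divr_gt0.
have -> : expR (- lam / N%:R) ^+ N = expR (- lam).
  by rewrite -expRM_natr divfK // gt_eqF.
have -> : expR (- lam / N%:R) ^+ a =
    expR (- lam) `^ c * expR (- (lam * d) / N%:R).
  rewrite -expRM_natr -expRM -expRD -aE; congr expR.
  by field; rewrite gt_eqF.
by rewrite /moment_profile /= invrK invfM -mulrA mulrC.
Qed.

Definition moment_correction lam c d (n : nat) : R :=
  let s := expR (- lam) in let L := (1 - s `^ c *: 'X) ^+ n.+1 in
  2^-1 * (binom_transform n ((1 - 'X) ^+ n.+1 * L)).[s] -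
  d / n.+1%:R * (binom_transform n ('X * ((1 - 'X) ^+ n.+1 * L^`()))).[s].

Lemma moment_profile_expansion lam c d (n : nat) : 0 < lam ->
  affine_expansion (moment_profile lam c d n) (Mq c lam n.+1)
    (moment_correction lam c d n).
Proof.
move=> lam_gt0; have lam_neq0 : lam != 0 by rewrite gt_eqF.
have p_neq0 : n.+1%:R != 0 :> R by rewrite pnatr_eq0.
have s_lt1 : expR (- lam) < 1 by rewrite expR_lt1 oppr_lt0.
have prefactorE := affine_expansionV (mulf_neq0 lam_neq0 p_neq0)
  (affine_expansion_oneB_expR (lam * n.+1%:R)).
pose s := expR (- lam).
have qaE : affine_expansion (fun h => s `^ c * expR (- (lam * d) * h))
    (s `^ c) (- (lam * d * s `^ c)).
  have := affine_expansionM (affine_expansion_cst (s `^ c))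
    (affine_expansion_expR (lam * d)).
  by move/affine_expansion_eq; apply => //; [rewrite mulr1 | ring].
have := affine_expansionM prefactorE
  (resummed_moment_expansion lam_gt0 s n qaE).
move/affine_expansion_eq; apply.
- move=> h _; rewrite /moment_profile -expRM_natr.
  by congr (((1 - expR _) / _)^-1 * _); ring.
- by rewrite /Mq horner_binom_transform.
- by rewrite /moment_correction /=; field; rewrite lam_neq0 nat1r p_neq0.
Qed.

Lemma moment_correction0 lam d (n : nat) : 0 < lam ->
  moment_correction lam 0 d n =
  2^-1 * betainc (1 - expR (- lam)) n.+2 n.+1 +
  d / 2 * 'C(2 * n.+1, n.+1)%:R * expR (- lam) ^+ n.+1 *
    (1 - expR (- lam)) ^+ n.+1.
Proof.
move=> lam_gt0; have s_lt1 : expR (- lam) < 1 by rewrite expR_lt1 oppr_lt0.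
rewrite /moment_correction; move: (expR (- lam)) s_lt1 => s s_lt1 /=.
rewrite powRr0 scale1r betaincE // -exprD; congr (_ + _).
set L : {poly R} := (1 - 'X) ^+ n.+1.
have -> : 'X * (L * L^`()) = 2^-1 *: ('X * (L * L)^`()).
  rewrite derivM [L^`() * L]mulrC -mulr2n mulrnAr.
  by rewrite -[('X * _) *+ 2]scaler_nat scalerA mulVf ?scale1r ?pnatr_eq0.
rewrite scale_coefZ scale_coef_X_deriv -exprD deriv_binom_transform_1subX.
rewrite beta_funV hornerZ.
set C := (n.+1 * _)%N; have CE : C = (n.+1 * 'C(2 * n.+1, n.+1))%N.
  by rewrite /C mul2n -addnn addnS.
have -> : ('X * (- C%:R *: ('X^n * (1 - 'X) ^+ n.+1))).[s] =
    - C%:R * s ^+ n.+1 * (1 - s) ^+ n.+1.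
  by rewrite -scalerAr mulrA -exprS hornerZ !hornerE.
by rewrite CE natrM; field; rewrite nat1r pnatr_eq0.
Qed.

End MomentProfile.

Theorem theorem1p1 (R : realType) (c : R) (d : nat) (lam : R) :
  0 <= c -> 0 < lam ->
  (forall p : nat, (1 <= p)%N ->
     forall eps : R, 0 < eps ->
     exists N0 : nat, forall N a : nat, (N0 <= N)%N ->
       c * N%:R + d%:R = a%:R ->
       `| qLUE_moment N a (expR (- lam / N%:R)) p / N%:R - Mq c lam p | < eps)
  /\
  (c = 0 ->
   forall p : nat, (1 <= p)%N ->
     exists C : R, exists N0 : nat, forall N : nat, (N0 <= N)%N ->
       `| qLUE_moment N d (expR (- lam / N%:R)) p
          - (N%:R * Mq 0 lam p
             + 2^-1 * betainc (1 - expR (- lam)) p.+1 p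
             + d%:R / 2 * 'C(2 * p, p)%:R * expR (- lam) ^+ p
                 * (1 - expR (- lam)) ^+ p) | <= C / N%:R).
Proof.
move=> _ lam_gt0; split=> [|_] [//|n] _.
- have profile_cvg :=
    affine_expansion_cvg (moment_profile_expansion c d%:R n lam_gt0).
  have /cvgrPdist_lt moment_cvg :=
    cvg_comp _ _ (@cvg_inv_nat_dnbhs R) profile_cvg.
  move=> eps /moment_cvg[N0 _ moment_lt]; exists (maxn n.+1 N0) => N a.
  rewrite geq_max => /andP[nN N0N] aE.
  by rewrite (qLUE_moment_profileE lam_gt0 nN aE) distrC; exact: moment_lt.
- have [C [N0 moment_le]] :=
    affine_expansion_nat (moment_profile_expansion 0 d%:R n lam_gt0).
  exists C, (maxn n.+1 N0) => N; rewrite geq_max => /andP[nN N0N].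
  have N_neq0 : N%:R != 0 :> R by rewrite pnatr_eq0 -lt0n (leq_trans _ nN).
  have := moment_le N N0N; rewrite moment_correction0 // addrA.
  by rewrite -(qLUE_moment_profileE (a := d)) ?mul0r ?add0r // mulrC divfK.
Qed.
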